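(* For every real number $p$ with $0 \leq p \leq \frac{1}{2}$, there is a many-one degree $\mathbf{a}$ such that $\Gamma_m(\mathbf{a}) = p$.
   Context: For $Z \subseteq \omega$, the lower density of $Z$ is $\underline{\rho}(Z) := \liminf_{n \to \infty} \frac{|Z \cap [0,n)|}{n}$. For sets $A, R \subseteq \omega$, let $A \leftrightarrow R := \{ x \mid x \in A \Longleftrightarrow x \in R \}$ be the set on which $A$ and $R$ agree. The coarse computability bound of a set $A \subseteq \omega$ is $\gamma(A) := \sup\{\underline{\rho}(A \leftrightarrow R) \mid R \subseteq \omega \text{ computable}\}$. For a many-one degree $\mathbf{a}$ (an equivalence class of subsets of $\omega$ under mutual many-one reducibility $\leq_m$), its coarse computability bound is $\Gamma_m(\mathbf{a}) := \inf\{\gamma(A) \mid A \leq_m \mathbf{a}\}$, where $A \leq_m \mathbf{a}$ means $A$ is many-one reducible to some (equivalently every) set in $\mathbf{a}$. *)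

(* Defs.v *)
From HB Require Import structures.
From mathcomp Require Import all_boot all_order all_algebra.
From mathcomp Require Import all_classical all_reals all_analysis.
From Stdlib Require Import List.

Set Implicit Arguments.
Unset Strict Implicit.
Unset Printing Implicit Defensive.
Import Order.TTheory GRing.Theory Num.Theory.

Inductive prf : Type :=
| pZero : prf
| pSucc : prf
| pProj : nat -> prf
| pComp : prf -> list prf -> prf
| pPrim : prf -> prf -> prf
| pMu   : prf -> prf.

Inductive eval : prf -> list nat -> nat -> Prop :=
| eZero v : eval pZero v 0
| eSucc x v : eval pSucc (x :: v) (S x)
| eProj i v x : List.nth_error v i = Some x -> eval (pProj i) v x
| eComp f gs v ys y : evals gs v ys -> eval f ys y -> eval (pComp f gs) v y
| ePrim0 f g v y : eval f v y -> eval (pPrim f g) (0 :: v) y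
| ePrimS f g n v r y :
    eval (pPrim f g) (n :: v) r -> eval g (n :: r :: v) y ->
    eval (pPrim f g) (S n :: v) y
| eMu f v n :
    eval f (n :: v) 0 ->
    (forall m, (m < n)%coq_nat -> exists k, eval f (m :: v) (S k)) ->
    eval (pMu f) v n
with evals : list prf -> list nat -> list nat -> Prop :=
| esNil v : evals nil v nil
| esCons g gs v y ys : eval g v y -> evals gs v ys -> evals (g :: gs) v (y :: ys).

Definition computable_fun (f : nat -> nat) : Prop :=
  exists e : prf, forall n, eval e (n :: nil) (f n).

Definition computable_set (Z : set nat) : Prop :=
  exists f : nat -> nat, computable_fun f /\ (forall n, f n <= 1)%N /\
    (forall n, Z n <-> f n = 1%N).

Definition many_one (A B : set nat) : Prop :=
  exists f : nat -> nat, computable_fun f /\ forall x, A x <-> B (f x).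

Local Open Scope ring_scope.
Local Open Scope classical_set_scope.

(* |Z ∩ [0,n)| / n  (as a real; 0 when n = 0, irrelevant for the liminf) *)
Definition density_upto {R : realType} (Z : set nat) (n : nat) : R :=
  (\sum_(i < n) (if `[< Z i >] then 1 else 0)) / n%:R.

Definition lower_density {R : realType} (Z : set nat) : \bar R :=
  limn_einf (fun n => (@density_upto R Z n)%:E).

Definition agree (A R : set nat) : set nat := [set x | A x <-> R x].

Definition gamma {R : realType} (A : set nat) : \bar R :=
  ereal_sup [set @lower_density R (agree A C) | C in computable_set].

(* Gamma_m(a) for the many-one degree a of B: inf of gamma(A) over A <=_m B.
   It depends only on the degree of B. *)
Definition Gamma_m {R : realType} (B : set nat) : \bar R :=
  ereal_inf [set @gamma R A | A in [set A | many_one A B]].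

(* Main.v *)
(** Let mu : nat -> [p, 1 - p] and choose B randomly, with the events z \in B
    independent of probability mu z.

    Lower bound. Let A = f^-1 B with f computable, and guess A by the computable
    set R of those x that are preceded by an odd number of y with f y = f x. Each
    x < n is guessed correctly with probability at least p, and on every fibre of
    f the guesses alternate, so the number of correct guesses below n is a
    constant plus a sum of independent terms, one for each fibre, of size at most
    1. Its variance is at most n, so that almost surely the agreement of A and R
    has lower density at least p.

    Upper bound. On the block [2^2^j, 2^2^(j+1)) choose mu so that B agrees with
    the e-th computable set with probability exactly p, where e is the 2-adic
    valuation of j. The end of a block is the square of its start, so that the
    density of the agreement at the end of a block is close to p.

    The random choice is derandomised: only the squared deviations at fourth
    powers n = k^4 of the first k requirements are controlled, a weighted sum of
    which has finite expectation, and the bits of B are chosen one at a time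
    without letting the conditional expectation exceed a fixed bound. *)
Require Import Defs.
From HB Require Import structures.
From mathcomp Require Import all_boot all_order all_algebra.
From mathcomp Require Import all_classical all_reals all_analysis.
From mathcomp Require Import ring lra.
Import Order.TTheory GRing.Theory Num.Theory.
Local Open Scope ring_scope.

(** * Computability *)

(** Descends into the list under [pComp], which the generated principle does not. *)
Definition prf_nested_ind (P : prf -> Prop)
    (P_zero : P pZero) (P_succ : P pSucc) (P_proj : forall i, P (pProj i))
    (P_comp : forall f gs, P f -> List.Forall P gs -> P (pComp f gs))
    (P_prim : forall f g, P f -> P g -> P (pPrim f g))
    (P_mu : forall f, P f -> P (pMu f)) : forall e, P e :=
  fix ind e := match e with
  | pZero => P_zero
  | pSucc => P_succ
  | pProj i => P_proj i
  | pComp f gs => P_comp f gs (ind f)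
      ((fix ind_gs (gs : list prf) : List.Forall P gs :=
          match gs with
          | nil => List.Forall_nil P
          | g :: gs => List.Forall_cons g (ind g) (ind_gs gs)
          end) gs)
  | pPrim f g => P_prim f g (ind f) (ind g)
  | pMu f => P_mu f (ind f)
  end.

Lemma eval_functional e v y y' : Defs.eval e v y -> Defs.eval e v y' -> y = y'.
Proof.
elim/prf_nested_ind: e v y y' => [||i|f gs IHf IHgs|f g IHf IHg|f IHf] v y y' H H'.
- by inversion H; inversion H'; subst.
- by inversion H; subst; inversion H'; subst.
- by inversion H; subst; inversion H'; subst; congruence.
- inversion H as [| | |? ? ? ys ? Hgs Hf| | |]; subst.
  inversion H' as [| | |? ? ? ys' ? Hgs' Hf'| | |]; subst.
  suff E : ys = ys' by subst; exact: IHf Hf Hf'.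
  elim: IHgs ys ys' Hgs Hgs' {Hf Hf' H H'} => [|g l Hg _ IH] ys ys' H H'.
    by inversion H; inversion H'.
  inversion H; subst; inversion H'; subst.
  by congr cons; [apply: Hg; eassumption | apply: IH].
- have [n [w Ev]] : exists n w, v = n :: w by inversion H; subst; eauto.
  subst v; elim: n y y' H H' => [|n IH] y y' H H'.
    by inversion H; subst; inversion H'; subst; apply: IHf; eassumption.
  inversion H as [| | | | |? ? ? ? r ? H1 H2|]; subst.
  inversion H' as [| | | | |? ? ? ? r' ? H1' H2'|]; subst.
  by move: H2'; rewrite -(IH _ _ H1 H1') => H2'; exact: IHg H2 H2'.
- inversion H as [| | | | | |? ? ? H1 H2]; subst.
  inversion H' as [| | | | | |? ? ? H1' H2']; subst.
  case: (ltngtP y y') => // lt_yy'.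
    have /H2' [k Hk] : (y < y')%coq_nat by exact/ssrnat.ltP.
    by have := IHf _ _ _ H1 Hk.
  have /H2 [k Hk] : (y' < y)%coq_nat by exact/ssrnat.ltP.
  by have := IHf _ _ _ H1' Hk.
Qed.

(** An embedding into a countable type, so that [pickle] numbers the programs. *)
Fixpoint tree_of_prf (e : prf) : GenTree.tree nat :=
  match e with
  | pZero => GenTree.Node 0 [::]
  | pSucc => GenTree.Node 1 [::]
  | pProj i => GenTree.Leaf i
  | pComp f gs => GenTree.Node 2 (tree_of_prf f :: map tree_of_prf gs)
  | pPrim f g => GenTree.Node 3 [:: tree_of_prf f; tree_of_prf g]
  | pMu f => GenTree.Node 4 [:: tree_of_prf f]
  end.

Fixpoint prf_of_tree (t : GenTree.tree nat) : prf :=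
  match t with
  | GenTree.Leaf i => pProj i
  | GenTree.Node 1 _ => pSucc
  | GenTree.Node 2 (f :: gs) => pComp (prf_of_tree f) (map prf_of_tree gs)
  | GenTree.Node 3 [:: f; g] => pPrim (prf_of_tree f) (prf_of_tree g)
  | GenTree.Node 4 [:: f] => pMu (prf_of_tree f)
  | _ => pZero
  end.

Lemma tree_of_prfK : cancel tree_of_prf prf_of_tree.
Proof.
elim/prf_nested_ind => //= [f gs -> IH|f g -> ->|f ->] //.
by congr pComp; elim: IH => //= g l -> _ ->.
Qed.

(** Programs are countable and each computes at most one total function. [F] comes from choice, with
    the default [id] at indices that compute no total function. *)
Lemma computable_fun_enum : exists F : nat -> nat -> nat,
  forall f, computable_fun f -> exists e, F e = f.
Proof.
pose spec (t : GenTree.tree nat) (f : nat -> nat) :=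
  forall n, Defs.eval (prf_of_tree t) [:: n] (f n).
have /choice [F HF] e : exists f, forall t, unpickle e = Some t ->
    forall g, spec t g -> g = f.
  case: (unpickle e) => [t|]; last by exists id.
  have [[f Hf]|noF] := pselect (exists f, spec t f).
    exists f => _ [<-] g Hg; apply/funext => n.
    exact: eval_functional (Hg n) (Hf n).
  by exists id => _ [<-] g Hg; case: noF; exists g.
exists F => f [e He]; exists (pickle (tree_of_prf e)).
symmetry; apply: HF (pickleK _) _ _ => n; rewrite tree_of_prfK; exact: He.
Qed.

Definition computable_on (k : nat) (g : seq nat -> nat) : Prop :=
  exists e, forall v, size v = k -> Defs.eval e v (g v).

Lemma computable_on1 g : computable_on 1 g <-> computable_fun (fun n => g [:: n]).
Proof.
split=> -[e He]; exists e; first by move=> n; exact: He.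
by move=> [|n[|]] // _; exact: He.
Qed.

Lemma computable_on_proj k i : (i < k)%N -> computable_on k (fun v => nth 0%N v i).
Proof.
move=> lt_ik; exists (pProj i) => v Hv; apply: eProj.
by elim: v i k Hv lt_ik => [|x v IH] [|i] [|k] //= [Hv] lt_ik; apply: IH Hv _.
Qed.

Lemma computable_on_comp1 k g h : computable_on k g -> computable_on 1 h ->
  computable_on k (fun v => h [:: g v]).
Proof.
move=> [eg Hg] [eh Hh]; exists (pComp eh [:: eg]) => v Hv.
apply: (@eComp _ _ _ [:: g v]); last exact: Hh.
by apply: esCons; [exact: Hg | exact: esNil].
Qed.

Lemma computable_on_comp2 k g1 g2 h :
  computable_on k g1 -> computable_on k g2 -> computable_on 2 h ->
  computable_on k (fun v => h [:: g1 v; g2 v]).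
Proof.
move=> [e1 H1] [e2 H2] [eh Hh]; exists (pComp eh [:: e1; e2]) => v Hv.
apply: (@eComp _ _ _ [:: g1 v; g2 v]); last exact: Hh.
apply: esCons; first exact: H1.
by apply: esCons; [exact: H2 | exact: esNil].
Qed.

Lemma computable_on_rec k (g h : seq nat -> nat) (r : nat -> seq nat -> nat) :
  computable_on k g -> computable_on k.+2 h ->
  (forall v, r 0%N v = g v) -> (forall n v, r n.+1 v = h (n :: r n v :: v)) ->
  computable_on k.+1 (fun v => r (head 0%N v) (behead v)).
Proof.
move=> [eg Hg] [eh Hh] r0 rS; exists (pPrim eg eh) => -[|n v] //= [Hv].
elim: n => [|n IH]; first by rewrite r0; apply: ePrim0; exact: Hg.
by rewrite rS; apply: ePrimS IH _; apply: Hh; rewrite /= Hv.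
Qed.

Lemma computable_on_succ : computable_on 1 (fun v => (head 0 v).+1).
Proof. by exists pSucc => -[|n[|]] // _; exact: eSucc. Qed.

Lemma computable_on_zero k : computable_on k (fun=> 0%N).
Proof. by exists pZero => v _; exact: eZero. Qed.

Lemma computable_on_pred : computable_on 1 (fun v => (head 0 v).-1).
Proof.
by apply: (computable_on_rec 0 (fun=> 0%N) _ (fun n _ => n.-1)
  (computable_on_zero 0) (computable_on_proj 2 0 isT)).
Qed.

Lemma computable_on_add : computable_on 2 (fun v => nth 0 v 0 + nth 0 v 1)%N.
Proof.
have H := computable_on_rec 1 _ _ (fun n v => n + nth 0 v 0)%N
  (computable_on_proj 1 0 isT)
  (computable_on_comp1 _ _ _ (computable_on_proj 3 1 isT) computable_on_succ).
have [|n v|e He] := H; [by [] | by rewrite addSn | ].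
by exists e => -[|m[|n[|]]] // Hv; exact: He.
Qed.

(* pPrim recurses on the first argument, hence the reversed order. *)
Lemma computable_on_sub : computable_on 2 (fun v => nth 0 v 1 - nth 0 v 0)%N.
Proof.
have H := computable_on_rec 1 _ _ (fun n v => nth 0 v 0 - n)%N
  (computable_on_proj 1 0 isT)
  (computable_on_comp1 _ _ _ (computable_on_proj 3 1 isT) computable_on_pred).
have [v|n v|e He] := H; [by rewrite subn0 | by rewrite subnS | ].
by exists e => -[|m[|n[|]]] // Hv; exact: He.
Qed.

(** On bits this is exclusive or, and [1 - absdiff m n] tests equality. *)
Definition absdiff (m n : nat) : nat := (n - m) + (m - n).

Lemma computable_on_absdiff k g h : computable_on k g -> computable_on k h ->
  computable_on k (fun v => absdiff (g v) (h v)).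
Proof.
move=> Hg Hh.
exact: (computable_on_comp2 _ _ _ _ (computable_on_comp2 _ _ _ _ Hg Hh computable_on_sub)
  (computable_on_comp2 _ _ _ _ Hh Hg computable_on_sub) computable_on_add).
Qed.

(** Taking [z] as a parameter in place of [f x] makes this a primitive recursion on [x]. *)
Definition parity_before (f : nat -> nat) (x z : nat) : bool :=
  odd (\sum_(y < x) (f y == z)).

Definition alternate (f : nat -> nat) (x : nat) : bool := parity_before f x (f x).

Lemma computable_alternate f :
  computable_fun f -> computable_fun (fun x => alternate f x : nat).
Proof.
move=> Hf.
have Hf1 : computable_on 1 (fun v => f (head 0%N v)) by apply/computable_on1.
(* The recursion step has as arguments x, the parity so far and the parameter z; the parity flips
   when f x = z. *)
have Hone : computable_on 3 (fun=> 1%N).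
  exact: computable_on_comp1 _ _ _ (computable_on_zero 3) computable_on_succ.
have Hfm := computable_on_comp1 _ _ _ (computable_on_proj 3 0 isT) Hf1.
have Hd := computable_on_absdiff _ _ _ Hfm (computable_on_proj 3 2 isT).
have Heq := computable_on_comp2 _ _ _ _ Hd Hone computable_on_sub.
have Hstep := computable_on_absdiff _ _ _ (computable_on_proj 3 1 isT) Heq.
have Hrec := computable_on_rec 1 _ _ (fun x v => parity_before f x (nth 0%N v 0) : nat)
  (computable_on_zero 1) Hstep.
have H2 : computable_on 2 (fun v => parity_before f (head 0%N v) (nth 0%N (behead v) 0)).
  apply: Hrec => [v|x v]; first by rewrite /parity_before big_ord0.
  rewrite /parity_before big_ord_recr oddD /=.
  have -> : (1 - absdiff (f x) (nth 0 v 0) = (f x == nth 0 v 0))%N.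
    rewrite /absdiff; case: (ltngtP (f x) (nth 0%N v 0)) => [H|H|->];
    by rewrite ?subnn //; apply/eqP; rewrite subn_eq0 addn_gt0 !subn_gt0 H ?orbT.
  by case: (odd _); case: (f x == _).
have := computable_on_comp2 _ _ _ _ (computable_on_proj 1 0 isT) Hf1 H2.
by move/computable_on1.
Qed.

(** * Derandomisation *)

(** Each [h k] is a nonnegative supermartingale for independent bits that are true with probability
    [mu]. If both extensions of a good [s] broke the bound, they would break it at a common [n], the
    partial sums being monotone, and so would their weighted average. *)
Lemma exists_bounded_path (R : realType) (mu : nat -> R)
    (h : nat -> seq bool -> R) (C : R) :
  (forall m, 0 <= mu m <= 1) ->
  (forall k s, 0 <= h k s) ->
  (forall k s, (1 - mu (size s)) * h k (rcons s false)
     + mu (size s) * h k (rcons s true) <= h k s) ->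
  (forall n, \sum_(k < n) h k [::] <= C) ->
  exists b : nat -> bool, forall m n, \sum_(k < n) h k (mkseq b m) <= C.
Proof.
move=> mu01 h_ge0 h_super h_nil.
pose good s := forall n, \sum_(k < n) h k s <= C.
have h_mono s n n' : (n <= n')%N -> \sum_(k < n) h k s <= \sum_(k < n') h k s.
  move=> le_nn'; rewrite -!(big_mkord xpredT (fun k => h k s)).
  by rewrite (big_cat_nat (leq0n n) le_nn') /= lerDl sumr_ge0.
have good_rcons s : good s -> exists x, good (rcons s x).
  move=> good_s; apply: contrapT => /forallNP bad.
  have /existsNP[n0 /negP] := bad false; rewrite -ltNge => H0.
  have /existsNP[n1 /negP] := bad true; rewrite -ltNge => H1.
  have {}H0 := lt_le_trans H0 (h_mono _ _ _ (leq_maxl n0 n1)).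
  have {}H1 := lt_le_trans H1 (h_mono _ _ _ (leq_maxr n0 n1)).
  move: (good_s (maxn n0 n1)); apply/negP; rewrite -ltNge.
  apply: (@lt_le_trans _ _ ((1 - mu (size s)) * \sum_(k < maxn n0 n1) h k (rcons s false)
     + mu (size s) * \sum_(k < maxn n0 n1) h k (rcons s true))); last first.
    by rewrite !big_distrr -big_split; apply: ler_sum => k _; exact: h_super.
  move: H0 H1 (mu01 (size s)) => /=.
  set A := \sum_(_ < _) _; set B := \sum_(_ < _) _; set u := mu _.
  rewrite -(subr_gt0 C A) -(subr_gt0 C B) => HA HB /andP[u0 u1].
  (* One of the two weights is at least 1/2, which keeps the average strictly above C. *)
  have [u_small|u_big] := lerP u (1/2).
    have : 0 < (1 - u) * (A - C) by apply: mulr_gt0 => //; lra.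
    have : 0 <= u * (B - C) by apply: mulr_ge0 => //; lra.
    by lra.
  have : 0 <= (1 - u) * (A - C) by apply: mulr_ge0; lra.
  have : 0 < u * (B - C) by apply: mulr_gt0 => //; lra.
  by lra.
have /choice[next next_good] s : exists x, good s -> good (rcons s x).
  by have [/good_rcons[x]|] := pselect (good s); [exists x | exists true].
pose path := fix path m := if m is m'.+1 then rcons (path m') (next (path m')) else [::].
pose b m := next (path m); exists b.
have pathE m : path m = mkseq b m.
  elim: m => //= m IH.
  by rewrite -[m.+1]addn1 /mkseq iotaD map_cat cats1 -/(mkseq b m) -IH.
by elim=> [|m IH] //; rewrite -pathE /=; apply: next_good; rewrite pathE.
Qed.

Lemma sum_inv_sqr (R : realType) n : \sum_(k < n) (k.+1%:R ^+ 2)^-1 <= 2 :> R.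
Proof.
(* The term - 1/(n+1) makes the induction telescope. *)
suff H : \sum_(k < n.+1) (k.+1%:R ^+ 2)^-1 <= 2 - n.+1%:R^-1 :> R.
  apply: (@le_trans _ _ (\sum_(k < n.+1) (k.+1%:R ^+ 2)^-1)).
    by rewrite big_ord_recr lerDl invr_ge0 exprn_ge0.
  by apply: le_trans H _; rewrite gerBl invr_ge0.
elim: n => [|n IH]; first by rewrite big_ord1 expr1n invr1; lra.
rewrite big_ord_recr /=; apply: le_trans (lerD IH (lexx _)) _.
rewrite -[n.+2%:R]natr1; set x : R := n.+1%:R.
have x0 : 0 < x by rewrite ltr0n.
have -> : 2 - x^-1 + ((x + 1) ^+ 2)^-1 =
    2 - (x + 1)^-1 - (x * (x + 1) ^+ 2)^-1.
  by field; rewrite !gt_eqF // addr_gt0.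
by rewrite gerBl invr_ge0 mulr_ge0 ?exprn_ge0 // ltW // addr_gt0.
Qed.

(** The hypothesis bounds the variance at n = (k+1)^4 by n. With weight (k+1)^-7 the k+1
    requirements of stage k contribute at most (k+1)^-2 in expectation, in total at most 2, so each
    weighted square can be kept at most 2. The resulting bound is of smaller order than n^2 =
    (k+1)^8. *)
Lemma exists_small_deviations (R : realType) (mu : nat -> R) (c : nat -> nat -> nat -> R) :
  (forall z, 0 <= mu z <= 1) ->
  (forall e n m, \sum_(z < m) c e n z ^+ 2 <= n%:R) ->
  exists b : nat -> bool, forall e k m, (e <= k)%N ->
    (\sum_(z < m) c e (k.+1 ^ 4)%N z * ((b z)%:R - mu z)) ^+ 2 <= 2 * k.+1%:R ^+ 7.
Proof.
move=> mu01 sum_c.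
pose D e k (s : seq bool) : R :=
  \sum_(z < size s) c e (k.+1 ^ 4)%N z * ((nth false s z)%:R - mu z).
pose w k : R := (k.+1%:R ^+ 7)^-1.
have w_ge0 k : 0 <= w k by rewrite invr_ge0 exprn_ge0.
(* The conditional expectation, given the bits s, of the final deviation squared,
   up to replacing the remaining variances by upper bounds. *)
pose cell e k s : R :=
  D e k s ^+ 2 + ((k.+1 ^ 4)%N%:R - \sum_(z < size s) c e (k.+1 ^ 4)%N z ^+ 2).
have le_cell e k s : D e k s ^+ 2 <= cell e k s by rewrite lerDl subr_ge0.
have cell_ge0 e k s : 0 <= cell e k s := le_trans (sqr_ge0 _) (le_cell e k s).
pose h k s := \sum_(e < k.+1) w k * cell e k s.
have [||||b Hb] := @exists_bounded_path R mu h 2.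
- exact: mu01.
- by move=> k s; apply: sumr_ge0 => e _; apply: mulr_ge0.
- move=> k s; rewrite /h !big_distrr -big_split; apply: ler_sum => e _ /=.
  rewrite (mulrCA (1 - _)) (mulrCA (mu _)) -mulrDr ler_wpM2l //.
  rewrite /cell /D !size_rcons !big_ord_recr /=.
  rewrite !nth_rcons ltnn eqxx /=.
  have E x : \sum_(z < size s) c e (k.+1 ^ 4)%N z * ((nth false (rcons s x) z)%:R - mu z)
      = D e k s by apply: eq_bigr => z _; rewrite nth_rcons ltn_ord.
  rewrite !E; move: (mu01 (size s)) => /andP[].
  set u := mu _; set d := D _ _ _; set a := c _ _ _; set S := \sum_(_ < _) _.
  set N := (_ ^ 4)%:R; move=> u0 u1.
  (* A new bit adds its variance a^2 u (1 - u) to the expected square, while the reserve for the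
     remaining bits drops by a^2. *)
  have : 0 <= a ^+ 2 * (1 - u * (1 - u)) by apply: mulr_ge0; [exact: sqr_ge0|nra].
  rewrite -[_ <= d ^+ 2 + _]subr_ge0; congr (_ <= _).
  rewrite (_ : false%:R = 0 :> R) // (_ : true%:R = 1 :> R) //.
  by ring.
- move=> n; apply: le_trans (sum_inv_sqr R n); apply: ler_sum => k _.
  rewrite /h /cell /D /= (eq_bigr (fun=> (k.+1%:R ^+ 3)^-1)); last first.
    move=> e _; rewrite !big_ord0 expr0n /= add0r subr0 /w natrX.
    have k0 : (k.+1%:R : R) != 0 by rewrite pnatr_eq0.
    by field.
  rewrite sumr_const card_ord -[leLHS]mulr_natl.
  have : (k.+1%:R : R) != 0 by rewrite pnatr_eq0.
  move: (k.+1%:R : R) => x x0.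
  by rewrite [X in X <= _](_ : _ = (x ^+ 2)^-1) //; field.
exists b => e k m le_ek.
have := Hb m k.+1; rewrite big_ord_recr /= => /(le_trans _) Hk.
have {}Hk : h k (mkseq b m) <= 2.
  apply: Hk; rewrite lerDr; apply: sumr_ge0 => i _; apply: sumr_ge0 => j _.
  exact: mulr_ge0.
have lt_ek : (e < k.+1)%N by [].
have : w k * D e k (mkseq b m) ^+ 2 <= 2.
  apply: le_trans Hk; rewrite /h (bigD1 (Ordinal lt_ek)) //=.
  apply: (@le_trans _ _ (w k * cell e k (mkseq b m))); first by rewrite ler_wpM2l.
  by rewrite lerDl; apply: sumr_ge0 => j _; exact: mulr_ge0.
rewrite /w mulrC ler_pdivrMr ?exprn_gt0 ?ltr0n //.
rewrite /D size_mkseq; congr (_ ^+ 2 <= _).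
by apply: eq_bigr => z _; rewrite nth_mkseq.
Qed.

(** * Agreement with a guess *)

(* The probability that the guess r is correct when the guessed bit is 1 with
   probability u. *)
Definition hit {R : realType} (r : bool) (u : R) : R := if r then u else 1 - u.

(* The coefficient of b z in the number of x < n with b (f x) = r x, as an
   affine function of b. *)
Definition discrepancy (R : realType) (f : nat -> nat) (r : nat -> bool) (n z : nat) : R :=
  \sum_(x < n | f x == z) (if r x then 1 else -1).

(** The condition on guesses that gives variance at most n: the squared coefficient of each bit is
    bounded by the size of its fibre below n. *)
Definition balanced (R : realType) (f : nat -> nat) (r : nat -> bool) : Prop :=
  forall n z, discrepancy R f r n z ^+ 2 <= (\sum_(x < n) (f x == z))%:R.

Lemma discrepancyS (R : realType) f r n z : discrepancy R f r n.+1 z =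
  discrepancy R f r n z + (if f n == z then (if r n then 1 else -1) else 0).
Proof. by rewrite /discrepancy big_mkcond big_ord_recr /= -big_mkcond. Qed.

(** On each fibre the signs run -1, 1, -1, ..., so their partial sums are 0 or -1. *)
Lemma balanced_alternate (R : realType) f : balanced R f (alternate f).
Proof.
move=> n z.
have -> : discrepancy R f (alternate f) n z = - (parity_before f n z)%:R.
  elim: n => [|n IH].
    by rewrite /discrepancy /parity_before !big_ord0 oppr0.
  rewrite discrepancyS IH /parity_before big_ord_recr oddD /=.
  case: eqP => [<-|_]; last by rewrite addr0 addbF.
  rewrite /alternate /parity_before addbT.
  by case: (odd _); rewrite /= ?addNr ?oppr0 ?add0r.
rewrite sqrrN -natrX ler_nat /parity_before.
by case E: (odd _) => //; rewrite exp1n odd_gt0.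
Qed.

Lemma balanced_id (R : realType) r : balanced R id r.
Proof.
move=> n z.
have -> : discrepancy R id r n z = if (z < n)%N then (if r z then 1 else -1) else 0.
  elim: n => [|n IH]; first by rewrite /discrepancy big_ord0.
  rewrite discrepancyS IH [in RHS]ltnS [in RHS]leq_eqVlt [z == n]eq_sym /=.
  by case: (eqVneq n z) => [->|_]; rewrite ?ltnn ?add0r ?addr0.
case: ltnP => [lt_zn|_]; last by rewrite expr0n.
rewrite (bigD1 (Ordinal lt_zn)) //= eqxx natrD.
by case: (r z); rewrite ?sqrrN expr1n lerDl.
Qed.

(** Each x < n lies in a single fibre, so the fibre sizes add up to at most n. *)
Lemma sum_discrepancy_sqr (R : realType) f r n m : balanced R f r ->
  \sum_(z < m) discrepancy R f r n z ^+ 2 <= n%:R.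
Proof.
move=> bal.
apply: (@le_trans _ _ (\sum_(z < m) (\sum_(x < n) (f x == z))%N%:R)).
  by apply: ler_sum => z _; exact: bal.
rewrite -natr_sum ler_nat exchange_big /=.
rewrite -[leqRHS]card_ord -sum1_card; apply: leq_sum => x _.
suff -> : (\sum_(z < m) (f x == z) = (f x < m))%N by exact: leq_b1.
elim: m => [|m IH]; first by rewrite big_ord0.
rewrite big_ord_recr /= IH ltnS [in RHS]leq_eqVlt.
by case: ltngtP.
Qed.

(** [hit] is affine in the probability with slope 1 or -1; grouping the x by fibre collects the
    slopes into [discrepancy]. *)
Lemma sum_hitB (R : realType) (f : nat -> nat) (r : nat -> bool) n m (u v : nat -> R) :
  (forall x, (x < n)%N -> (f x < m)%N) ->
  \sum_(x < n) hit (r x) (u (f x)) - \sum_(x < n) hit (r x) (v (f x)) =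
  \sum_(z < m) discrepancy R f r n z * (u z - v z).
Proof.
move=> f_lt; rewrite -sumrB.
under [RHS]eq_bigr => z _ do rewrite /discrepancy big_mkcond big_distrl /=.
rewrite exchange_big; apply: eq_bigr => x _ /=.
rewrite (bigD1 (Ordinal (f_lt x (ltn_ord x)))) //= eqxx big1 ?addr0.
  by rewrite /hit; case: (r x); ring.
by move=> z /eqP ne; case: eqP => [E|_]; rewrite ?mul0r //; case: ne; apply: val_inj.
Qed.

Lemma exists_typical_set (R : realType) (mu : nat -> R)
    (f : nat -> nat -> nat) (r : nat -> nat -> bool) :
  (forall z, 0 <= mu z <= 1) -> (forall e, balanced R (f e) (r e)) ->
  exists b : nat -> bool, forall e (eps : R), 0 < eps -> exists K, forall k, (K <= k)%N ->
    `|\sum_(x < k ^ 4) hit (r e x) (b (f e x))%:R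
      - \sum_(x < k ^ 4) hit (r e x) (mu (f e x))| <= eps * k%:R ^+ 4.
Proof.
move=> mu01 bal.
have [b Hb] := @exists_small_deviations R mu (fun e => discrepancy R (f e) (r e)) mu01
  (fun e n m => sum_discrepancy_sqr _ _ _ n m (bal e)).
exists b => e eps eps0.
(* Chosen so that 2 x^7 <= (eps x^4)^2 once x > 2 / eps^2. *)
pose K0 := Num.truncn (2 / eps ^+ 2).
exists (maxn e K0).+1 => -[//|k]; rewrite ltnS geq_max => /andP[le_ek le_Kk].
(* The range of z must exceed all values of [f e] below (k+1)^4, so that every fibre is counted. *)
have f_lt x : (x < k.+1 ^ 4)%N -> (f e x < (\max_(y < k.+1 ^ 4) f e y).+1)%N.
  by move=> lt_x; rewrite ltnS (leq_bigmax (Ordinal lt_x)).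
rewrite (sum_hitB _ _ _ _ _ (fun z => (b z)%:R) mu f_lt).
have := Hb e k (\max_(y < k.+1 ^ 4) f e y).+1 le_ek.
set d := \sum_(_ < _) _; set x : R := k.+1%:R => Hd.
have x0 : 0 < x by rewrite ltr0n.
have ltx : 2 / eps ^+ 2 < x.
  apply: lt_le_trans (truncnS_gt _) _; by rewrite ler_nat ltnS.
rewrite -(@ler_pXn2r _ 2) ?nnegrE ?mulr_ge0 ?exprn_ge0 ?(ltW x0) ?(ltW eps0) //.
rewrite real_normK ?num_real //; apply: le_trans Hd _.
have -> : (eps * x ^+ 4) ^+ 2 = (eps ^+ 2 * x) * x ^+ 7 by ring.
rewrite ler_wpM2r ?exprn_ge0 ?(ltW x0) //.
by rewrite mulrC -ler_pdivrMr ?exprn_gt0 // ltW.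
Qed.

(** * Lower densities *)

Lemma limn_einfE (R : realType) (u : nat -> \bar R) :
  limn_einf u = ereal_sup (range (einfs u)).
Proof. by rewrite limn_einf_lim; apply/cvg_lim => //; exact: cvg_einfs_sup. Qed.

Lemma limn_einf_ge (R : realType) (u : nat -> R) (p : R) :
  (forall eps, 0 < eps -> exists N, forall n, (N <= n)%N -> p - eps <= u n) ->
  (p%:E <= limn_einf (EFin \o u))%E.
Proof.
move=> H; apply/lee_subgt0Pr => eps /H[N HN]; rewrite limn_einfE.
apply: le_ereal_sup_tmp; exists (einfs (EFin \o u) N); first by exists N.
apply: le_ereal_inf_tmp => _ [n /= le_Nn <-].
by rewrite -EFinB lee_fin; exact: HN.
Qed.

Lemma limn_einf_le (R : realType) (u : nat -> R) (p : R) :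
  (forall eps N, 0 < eps -> exists2 n, (N <= n)%N & u n <= p + eps) ->
  (limn_einf (EFin \o u) <= p%:E)%E.
Proof.
move=> H; rewrite limn_einfE; apply: ge_ereal_sup => _ [N _ <-].
apply/lee_addgt0Pr => eps /(H _ N)[n le_Nn le_un].
apply: ge_ereal_inf; exists (u n)%:E; first by exists n.
by rewrite -EFinD lee_fin.
Qed.

Lemma fourth_power_bracket n : exists k, (k ^ 4 <= n < k.+1 ^ 4)%N.
Proof.
elim: n => [|n [k /andP[le_kn lt_nk]]]; first by exists 0%N.
move: lt_nk; rewrite leq_eqVlt => /predU1P[->|lt_nk].
  by exists k.+1; rewrite leqnn ltn_exp2r // ltnSn.
by exists k; rewrite lt_nk (leq_trans le_kn).
Qed.

(** 15 = 4 + 6 + 4 + 1; expanded in powers of x - 1, the difference has nonnegative coefficients. *)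
Lemma fourth_power_gap (R : realType) (x : R) : 1 <= x ->
  (x + 1) ^+ 4 - x ^+ 4 <= 15 * x ^+ 3.
Proof.
move=> x1; rewrite -subr_ge0.
have -> : 15 * x ^+ 3 - ((x + 1) ^+ 4 - x ^+ 4) =
  11 * (x - 1) ^+ 3 + 27 * (x - 1) ^+ 2 + 17 * (x - 1) by ring.
have H : 0 <= x - 1 by rewrite subr_ge0.
by rewrite !addr_ge0 // mulr_ge0 // exprn_ge0.
Qed.

(** The ratio of consecutive fourth powers tends to 1, so a monotone count loses little between
    them. *)
Lemma linear_lower_bound (R : realType) (N : nat -> R) (p : R) :
  0 <= p <= 1 -> nondecreasing_seq N ->
  (forall eps, 0 < eps -> exists K, forall k, (K <= k)%N ->
     (p - eps) * k%:R ^+ 4 <= N (k ^ 4)%N) ->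
  forall eps, 0 < eps -> exists n0, forall n, (n0 <= n)%N -> (p - eps) * n%:R <= N n.
Proof.
move=> /andP[p0 p1] N_mono HN eps eps0.
have [|K HK] := HN (eps / 2); first by rewrite divr_gt0.
(* Beyond 30 / eps the gap 15 x^3 is at most (eps / 2) x^4. *)
pose K' := maxn K (Num.truncn (30 / eps)).+1.
exists (K' ^ 4)%N => n le_n.
have [k /andP[le_kn lt_nk]] := fourth_power_bracket n.
have le_Kk : (K' <= k)%N by rewrite -ltnS -(@ltn_exp2r _ _ 4) // (leq_ltn_trans le_n).
move: le_Kk; rewrite geq_max => /andP[le_Kk lt_k].
have {}HK := le_trans (HK k le_Kk) (N_mono _ _ le_kn); apply: le_trans HK.
set x : R := k%:R in HN *.
have x1 : 1 <= x by rewrite ler1n (leq_trans _ lt_k).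
have ltx : 30 / eps < x by apply: lt_le_trans (truncnS_gt _) _; rewrite ler_nat.
have gap : n%:R <= x ^+ 4 + 15 * x ^+ 3.
  have := fourth_power_gap R x x1; rewrite lerBlDl natr1 -natrX => /(le_trans _); apply.
  by rewrite ler_nat ltnW.
have le_xn : x ^+ 4 <= n%:R by rewrite -natrX ler_nat.
have x3 : 15 * x ^+ 3 <= eps / 2 * x ^+ 4.
  rewrite [x ^+ 4]exprS [leRHS]mulrA.
  rewrite ler_wpM2r ?exprn_ge0 ?(le_trans ler01) //.
  by move: ltx; rewrite ltr_pdivrMr // => ltx; lra.
have : p * (n%:R - x ^+ 4) <= eps / 2 * x ^+ 4.
  apply: le_trans (_ : 1 * (n%:R - x ^+ 4) <= _); last by lra.
  by rewrite ler_wpM2r // subr_ge0.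
have : eps * x ^+ 4 <= eps * n%:R by rewrite ler_wpM2l // ltW.
by lra.
Qed.

Lemma density_upto_agree (R : realType) (A C : set nat) (b r : nat -> bool) (n : nat) :
  (forall x, A x <-> b x) -> (forall x, C x <-> r x) ->
  density_upto (agree A C) n = (\sum_(x < n) hit (r x) (b x)%:R) / n%:R :> R.
Proof.
move=> HA HC; congr (_ / _); apply: eq_bigr => x _.
have -> : `[< agree A C x >] = (b x == r x).
  apply/asboolP/eqP => [[H1 H2]|E].
    by apply/idP/idP => H; [apply/HC/H1/HA | apply/HA/H2/HC].
  by split=> H; [apply/HC; rewrite -E; apply/HA | apply/HA; rewrite E; apply/HC].
by rewrite /hit; case: (b x); case: (r x); rewrite /= ?subr0 ?subrr.
Qed.

Lemma hit_bounds (R : realType) r (u : R) : 0 <= u <= 1 -> 0 <= hit r u <= 1.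
Proof. by rewrite /hit => /andP[u0 u1]; case: r; apply/andP; split; lra. Qed.

Lemma hit_bool_bounds (R : realType) r (b : bool) : 0 <= hit r (b%:R : R) <= 1.
Proof. by apply: hit_bounds; rewrite ler0n lern1 leq_b1. Qed.

Lemma lower_density_ge (R : realType) (A C : set nat) (b r : nat -> bool) (q : nat -> R) (p : R) :
  0 <= p <= 1 -> (forall x, A x <-> b x) -> (forall x, C x <-> r x) ->
  (forall x, p <= q x) ->
  (forall eps, 0 < eps -> exists K, forall k, (K <= k)%N ->
    `|\sum_(x < k ^ 4) hit (r x) (b x)%:R - \sum_(x < k ^ 4) q x| <= eps * k%:R ^+ 4) ->
  (p%:E <= lower_density (agree A C))%E.
Proof.
move=> p01 HA HC le_pq H; apply: limn_einf_ge => eps eps0.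
pose N n : R := \sum_(x < n) hit (r x) (b x)%:R.
have [||n0 Hn0] := @linear_lower_bound R N p p01 _ _ eps eps0.
- move=> m n le_mn; rewrite /N -!(big_mkord xpredT (fun x => hit (r x) (b x)%:R)).
  rewrite (big_cat_nat (leq0n m) le_mn) /= lerDl sumr_ge0 // => x _.
  by case/andP: (hit_bool_bounds R (r x) (b x)).
- move=> {}eps {}eps0; have [K HK] := H eps eps0; exists K => k /HK.
  rewrite ler_norml => /andP[+ _]; rewrite -/(N _) => HN.
  have : p * k%:R ^+ 4 <= \sum_(x < k ^ 4) q x.
    rewrite -natrX mulr_natr -[in leLHS](card_ord (k ^ 4)) -sumr_const.
    by apply: ler_sum => x _.
  by lra.
exists n0.+1 => n lt_n; rewrite (density_upto_agree _ _ _ _ _ _ HA HC).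
by rewrite ler_pdivlMr ?ltr0n ?(leq_trans _ lt_n) //; apply: Hn0; exact: ltnW.
Qed.

(** At n = k^4 the places below k^2 contribute at most k^2, which is negligible against n, and all
    others have expectation exactly p. *)
Lemma lower_density_le (R : realType) (A C : set nat) (b r : nat -> bool) (q : nat -> R) (p : R) :
  0 <= p -> (forall x, A x <-> b x) -> (forall x, C x <-> r x) ->
  (forall x, q x <= 1) ->
  (forall K, exists2 k, (K <= k)%N & forall x, (k ^ 2 <= x < k ^ 4)%N -> q x = p) ->
  (forall eps, 0 < eps -> exists K, forall k, (K <= k)%N ->
    `|\sum_(x < k ^ 4) hit (r x) (b x)%:R - \sum_(x < k ^ 4) q x| <= eps * k%:R ^+ 4) ->
  (lower_density (agree A C) <= p%:E)%E.
Proof.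
move=> p0 HA HC q1 Hq H; apply: limn_einf_le => eps N eps0.
have [|K HK] := H (eps / 2); first by rewrite divr_gt0.
have [k] := Hq (maxn (maxn K N) (Num.truncn (2 / eps)).+1).
rewrite !geq_max => /andP[/andP[le_K le_N] lt_k] qE.
have k0 : (0 < k)%N by rewrite (leq_trans _ lt_k).
have le_k24 : (k ^ 2 <= k ^ 4)%N by rewrite leq_pexp2l.
exists (k ^ 4)%N; first by rewrite (leq_trans le_N) // -[leqLHS]expn1 leq_pexp2l.
rewrite (density_upto_agree _ _ _ _ _ _ HA HC).
rewrite ler_pdivrMr ?ltr0n ?expn_gt0 ?k0 // natrX.
have := HK k le_K; rewrite ler_norml => /andP[_].
have : \sum_(x < k ^ 4) q x <= k%:R ^+ 2 + p * k%:R ^+ 4.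
  rewrite -(big_mkord xpredT q) (big_cat_nat (leq0n _) le_k24) /=; apply: lerD.
    rewrite big_mkord -natrX -[in leRHS](card_ord (k ^ 2)) -sumr_const.
    by apply: ler_sum => x _.
  rewrite (eq_big_nat _ _ qE) sumr_const_nat -natrX -[leLHS]mulr_natr.
  by rewrite ler_wpM2l // ler_nat leq_subr.
set x : R := k%:R; have x1 : 1 <= x by rewrite ler1n.
have ltx : 2 / eps < x by apply: lt_le_trans (truncnS_gt _) _; rewrite ler_nat.
have : x ^+ 2 <= eps / 2 * x ^+ 4.
  have -> : eps / 2 * x ^+ 4 = (eps / 2 * x * x) * x ^+ 2 by ring.
  rewrite -[leLHS]mul1r ler_wpM2r ?sqr_ge0 //.
  move: ltx; rewrite ltr_pdivrMr // => ltx; apply: le_trans (_ : eps / 2 * x <= _); first by lra.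
  by rewrite ler_peMr // mulr_ge0 ?divr_ge0 ?(ltW eps0) // (le_trans ler01).
by lra.
Qed.

(** * Doubly exponential blocks and the final construction *)

Definition block (z : nat) : nat := trunc_log 2 (trunc_log 2 z).

Lemma block_eq j z : (2 ^ 2 ^ j <= z < 2 ^ 2 ^ j.+1)%N -> block z = j.
Proof.
move=> /andP[le_z lt_z]; have z0 : (0 < z)%N by rewrite (leq_trans _ le_z) // expn_gt0.
apply: trunc_log_eq => //; apply/andP; split.
  by apply: trunc_log_max.
by rewrite -(@ltn_exp2l 2) // (leq_ltn_trans _ lt_z) // trunc_logP.
Qed.

Lemma logn2_unbounded e J : exists2 j, (J <= j)%N & logn 2 j = e.
Proof.
exists (2 ^ e * J.*2.+1)%N.
  apply: (@leq_trans J.*2.+1); first by rewrite -addnn leqW // leq_addr.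
  by rewrite leq_pmull // expn_gt0.
rewrite lognM ?expn_gt0 // pfactorK // logn_coprime ?addn0 //.
by rewrite coprime2n /= odd_double.
Qed.

Lemma logn2_block_frequent e K : exists2 k, (K <= k)%N &
  forall z, (k ^ 2 <= z < k ^ 4)%N -> logn 2 (block z) = e.
Proof.
have [j] := logn2_unbounded e K.+1; case: j => // j; rewrite ltnS => le_Kj logj.
(* With this k, the numbers k^2 and k^4 are the two ends of block j+1, whose index has valuation
   e. *)
exists (2 ^ 2 ^ j)%N.
  apply: (leq_trans le_Kj); apply: ltnW; apply: (@ltn_trans (2 ^ j)); exact: ltn_expl.
move=> z; rewrite -!expnM -expnSr -[4%N]/(2 ^ 2)%N -expnD addn2 => Hz.
by rewrite (block_eq _ _ Hz).
Qed.

Lemma many_one_refl (B : set nat) : many_one B B.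
Proof.
exists id; split=> [|x] //; exists (pProj 0) => n; exact: eProj.
Qed.

(* Every p in [0, 1/2] is Gamma_m(a) for some many-one degree a,
   the degree being represented by a set B ⊆ ω. *)
Theorem theorem1p8 (R : realType) (p : R) :
  0 <= p -> p <= 2^-1 ->
  exists B : set nat, @Gamma_m R B = p%:E.
Proof.
move=> p0 p_half.
have p01 : 0 <= p <= 1 by apply/andP; split; lra.
have [F HF] := computable_fun_enum.
pose ind e x := F e x == 1%N.
(* For a fixed guess [hit] is an involution, so in a block assigned to e the guess [ind e] is
   correct with probability exactly p. *)
pose mu z := hit (ind (logn 2 (block z)) z) p.
have mu01 z : 0 <= mu z <= 1 by exact: hit_bounds.
(* Any guess is correct with probability p or 1 - p, and p is the smaller as p <= 1/2. *)
have hit_mu s z : p <= hit s (mu z).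
  by rewrite /mu /hit; case: (ind _ _); case: s; lra.
(* One typical set serves both bounds: even indices list the reductions with their alternating
   guesses, odd indices the computable sets as guesses for B itself. *)
pose f i := if odd i then id else F i./2.
pose r i := if odd i then ind i./2 else alternate (F i./2).
have bal i : balanced R (f i) (r i).
  by rewrite /f /r; case: odd; [exact: balanced_id | exact: balanced_alternate].
have [b Hb] := exists_typical_set R mu f r mu01 bal.
pose B : set nat := [set x | b x]%classic; exists B; apply/eqP; rewrite eq_le; apply/andP; split.
- apply: ge_ereal_inf; exists (gamma B); first by exists B => //; exact: many_one_refl.
  apply: ge_ereal_sup => _ [C [g [/HF[e <-] [_ HC]]] <-].
  apply: (@lower_density_le R B C b (ind e) (fun x => hit (ind e x) (mu x))) => //.
  + by move=> x; rewrite HC; split=> /eqP.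
  + by move=> x; case/andP: (hit_bounds R (ind e x) _ (mu01 x)).
  + move=> K; have [k le_Kk Hk] := logn2_block_frequent e K; exists k => // x /Hk Ex.
    by rewrite /mu Ex /hit; case: (ind e x); rewrite // opprB addrCA subrr addr0.
  + move=> eps eps0; have := Hb e.*2.+1 eps eps0.
    by rewrite /f /r /= odd_double uphalf_double.
- apply: le_ereal_inf_tmp => _ [A [g [computable_g HA]] <-].
  have [e Ee] := HF g computable_g.
  apply: le_ereal_sup_tmp; exists (lower_density (agree A [set x | alternate g x]%classic)).
    exists [set x | alternate g x]%classic => //; exists (fun x => alternate g x : nat).
    split; first exact: computable_alternate.
    by split=> x; [exact: leq_b1 | rewrite /=; case: (alternate g x)].
  apply: (@lower_density_ge R A _ (b \o g) (alternate g)
    (fun x => hit (alternate g x) (mu (g x)))) => //.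
  move=> eps eps0; have := Hb e.*2 eps eps0.
  by rewrite /f /r odd_double doubleK Ee.
Qed.
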